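(* Let $(G,P,\theta)$ be an algebraic dynamical system with $P$ directed which is minimal, that is, $\bigcap_{p\in P}\theta_p(G)=\{1_G\}$. Suppose that the assignment $u_gs_ps_q^*u_h^*\mapsto \delta_{g,h}\,\delta_{p,q}\,u_gs_ps_p^*u_g^*$ ($g,h\in G$, $p,q\in P$) defines a faithful conditional expectation $\Theta\colon\mathcal{Q}(G\rtimes_\theta P)\to\mathcal{D}$, and that for all $p,q\in P$ with $p\neq q$ every $g\in G$ has only finitely many preimages under the map $\Phi_{p,q}\colon G\to G$, $\Phi_{p,q}(h)=\theta_p(h)\theta_q(h)^{-1}$. Then the diagonal $\mathcal{D}$ is a Cartan subalgebra of $\mathcal{Q}(G\rtimes_\theta P)$.
   Context: An algebraic dynamical system is a triple $(G,P,\theta)$ where $G$ is a countable discrete group; $P$ is a right LCM semigroup, i.e. a countable left cancellative monoid in which the intersection of two principal right ideals is either empty or another principal right ideal; and $\theta$ is an action of $P$ on $G$ by injective group endomorphisms $\theta_p$ which respects the order: $pP\cap qP=rP$ implies $\theta_p(G)\cap\theta_q(G)=\theta_r(G)$. $P$ is directed if it is directed with respect to $p\geq q \Leftrightarrow p\in qP$, i.e. $pP\cap qP\neq\emptyset$ for all $p,q\in P$. Write $N_p=[G:\theta_p(G)]$. For directed $P$, the boundary quotient $\mathcal{Q}(G\rtimes_\theta P)$ is the universal $C^*$-algebra generated by a unitary representation $u$ of $G$ and a representation $s$ of the monoid $P$ by isometries satisfying (I) $s_pu_g=u_{\theta_p(g)}s_p$; (II) $s_p^*u_gs_q=u_{g_1}s_{p'}s_{q'}^*u_{g_2}$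 if $g=\theta_p(g_1)\theta_q(g_2)$ and $pP\cap qP=pp'P$, $pp'=qq'$, and $s_p^*u_gs_q=0$ otherwise; (III) $\sum_{[g]\in G/\theta_p(G)}u_gs_ps_p^*u_g^*=1$ whenever $N_p<\infty$. The diagonal $\mathcal{D}$ is the commutative $C^*$-subalgebra of $\mathcal{Q}(G\rtimes_\theta P)$ generated by the projections $u_gs_ps_p^*u_g^*$, $g\in G$, $p\in P$; it is the closed linear span of these projections. A Cartan subalgebra (in the sense of Renault) of a unital $C^*$-algebra $A$ is a maximal abelian $C^*$-subalgebra $B\subset A$ containing the unit, such that there is a faithful conditional expectation $A\to B$ and the normalizer $\{a\in A\mid aBa^*\subset B,\ a^*Ba\subset B\}$ generates $A$ as a $C^*$-algebra.
   Formalization: Added hypothesis: G is nontrivial or P is trivial. For G trivial and P nontrivial the claim fails: e.g. G={1}, P=N gives Q=C(T) with Haar integration as the expectation and D=C1, which is not maximal abelian. *)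

(* Defs.v *)
From HB Require Import structures.
From mathcomp Require Import all_boot all_order all_algebra.
From mathcomp Require Import all_classical all_reals.
From mathcomp Require Import complex.

Set Implicit Arguments.
Unset Strict Implicit.
Unset Printing Implicit Defensive.

Import Order.TTheory GRing.Theory Num.Theory.

Local Open Scope classical_set_scope.
Local Open Scope ring_scope.
Local Open Scope complex_scope.

(* Unital nonzero complex C*-algebras.  The norm is a field of its own, with  *)
(* values in R, because the hierarchy has no join of the algebra and normed   *)
(* module structures.  On the scalars, `|c| : R[i], hence the Re in cnormZ.   *)
HB.mixin Record isCStarAlgebra (R : realType) A of GRing.Algebra R[i] A := {
  star : A -> A ;
  cnorm : A -> R ;
  starK : involutive star ;
  starD : {morph star : x y / x + y} ;
  starZ : forall (c : R[i]) (x : A), star (c *: x) = c^* *: star x ;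
  starM : forall x y : A, star (x * y) = star y * star x ;
  cnorm_eq0 : forall x : A, cnorm x = 0 -> x = 0 ;
  cnormZ : forall (c : R[i]) (x : A), cnorm (c *: x) = complex.Re `|c| * cnorm x ;
  cnormD_le : forall x y : A, cnorm (x + y) <= cnorm x + cnorm y ;
  cnormM_le : forall x y : A, cnorm (x * y) <= cnorm x * cnorm y ;
  cnorm_starM : forall x : A, cnorm (star x * x) = cnorm x ^+ 2 ;
  cnorm_complete : forall a : nat -> A,
    (forall e : R, 0 < e -> exists N, forall m n,
       (N <= m)%N -> (N <= n)%N -> cnorm (a m - a n) < e) ->
    exists l : A, forall e : R, 0 < e -> exists N, forall n,
       (N <= n)%N -> cnorm (a n - l) < e
}.

#[short(type="cstarAlgType")]
HB.structure Definition CStarAlgebra (R : realType) :=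
  {A of GRing.Algebra R[i] A & isCStarAlgebra R A}.

Section CStarSubalgebras.
Context {R : realType} {A : cstarAlgType R}.
Implicit Types (B S : set A) (E : A -> A).

Definition norm_closed B : Prop :=
  forall x, (forall e : R, 0 < e -> exists2 y, B y & cnorm (x - y) < e) -> B x.

Record cstar_subalgebra B : Prop := {
  cstar_subalgebra0 : B 0 ;
  cstar_subalgebraD : forall x y, B x -> B y -> B (x + y) ;
  cstar_subalgebraZ : forall (c : R[i]) x, B x -> B (c *: x) ;
  cstar_subalgebraM : forall x y, B x -> B y -> B (x * y) ;
  cstar_subalgebra_star : forall x, B x -> B (star x) ;
  cstar_subalgebra_closed : norm_closed B
}.

Definition cstar_generated S : set A :=
  \bigcap_(B in [set B | cstar_subalgebra B /\ S `<=` B]) B.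

Definition abelian_set B : Prop := forall x y, B x -> B y -> x * y = y * x.

Definition maximal_abelian B : Prop :=
  [/\ cstar_subalgebra B, abelian_set B &
      forall B', cstar_subalgebra B' -> abelian_set B' ->
        B `<=` B' -> B' = B].

Record conditional_expectation B E : Prop := {
  condexp_linear : linear E ;
  condexp_range : forall x, B (E x) ;
  condexp_id : forall b, B b -> E b = b ;
  condexp_contractive : forall x, cnorm (E x) <= cnorm x ;
  condexp_positive : forall x, exists y, E (star x * x) = star y * y ;
  condexp_bimodule : forall b x b', B b -> B b' -> E (b * x * b') = b * E x * b'
}.

Definition faithful_map E : Prop := forall x, E (star x * x) = 0 -> x = 0.

Definition cstar_normalizer B : set A :=
  [set a | (forall b, B b -> B (a * b * star a)) /\
           (forall b, B b -> B (star a * b * a))].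

Record cartan_subalgebra B : Prop := {
  cartan_maximal_abelian : maximal_abelian B ;
  cartan_unit : B 1 ;
  cartan_condexp : exists2 E, conditional_expectation B E & faithful_map E ;
  cartan_regular : cstar_generated (cstar_normalizer B) = setT
}.

End CStarSubalgebras.

Definition right_ideal {P : monoidType} (p : P) : set P :=
  range (fun x : P => (p * x)%g).

(* [{multiplicative G -> G}] is the type of group endomorphisms of G. *)
Record algebraic_dynamical_system (G : groupType) (P : monoidType)
    (theta : P -> {multiplicative G -> G}) : Prop := {
  ads_countableG : countable [set: G] ;
  ads_countableP : countable [set: P] ;
  ads_left_cancellative : forall p : P, injective (fun x : P => (p * x)%g) ;
  ads_right_LCM : forall p q : P,
    right_ideal p `&` right_ideal q = set0 \/
    exists r, right_ideal p `&` right_ideal q = right_ideal r ;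
  ads_theta1 : forall g, theta 1%g g = g ;
  ads_thetaM : forall p q g, theta (p * q)%g g = theta p (theta q g) ;
  ads_theta_inj : forall p, injective (theta p) ;
  ads_order : forall p q r,
    right_ideal p `&` right_ideal q = right_ideal r ->
    range (theta p) `&` range (theta q) = range (theta r)
}.

Definition directed_monoid (P : monoidType) : Prop :=
  forall p q : P, right_ideal p `&` right_ideal q !=set0.

Definition minimal_action (G : groupType) (P : monoidType)
    (theta : P -> {multiplicative G -> G}) : Prop :=
  \bigcap_(p in [set: P]) range (theta p) = [set 1%g].

(* The excluded case, G trivial and P nontrivial, is a genuine exception: for *)
(* G = 1 and P = (nat, +) the boundary quotient is C(T) with Haar integration *)
(* as Theta, and the diagonal is the scalars, which is not maximal abelian.   *)
Definition nondegenerate_pair (G : groupType) (P : monoidType) : Prop :=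
  (exists g : G, g != 1%g) \/ (forall p : P, p = 1%g).

(* A finite complete irredundant list of representatives of the left cosets   *)
(* of H; one exists exactly when H has finite index.                          *)
Definition left_transversal (G : groupType) (H : set G) (t : seq G) : Prop :=
  uniq t /\ forall g : G, exists! h, h \in t /\ H (h^-1 * g)%g.

Section BoundaryQuotient.
Context {R : realType} {G : groupType} {P : monoidType}.
Variable theta : P -> {multiplicative G -> G}.

Definition range_projection {A : cstarAlgType R} (u : G -> A) (s : P -> A)
    (g : G) (p : P) : A :=
  u g * s p * star (s p) * star (u g).

Definition factorization (p q : P) (g : G) (p' q' : P) (g1 g2 : G) : Prop :=
  [/\ g = (theta p g1 * theta q g2)%g,
      right_ideal p `&` right_ideal q = right_ideal (p * p')%g &
      (p * p')%g = (q * q')%g].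

Record boundary_relations (A : cstarAlgType R) (u : G -> A) (s : P -> A) :
    Prop := {
  brel_uM : forall g h, u (g * h)%g = u g * u h ;
  brel_unitary : forall g, star (u g) * u g = 1 /\ u g * star (u g) = 1 ;
  brel_s1 : s 1%g = 1 ;
  brel_sM : forall p q, s (p * q)%g = s p * s q ;
  brel_isometry : forall p, star (s p) * s p = 1 ;
  brel_I : forall p g, s p * u g = u (theta p g) * s p ;
  brel_II : forall p q g p' q' g1 g2, factorization p q g p' q' g1 g2 ->
    star (s p) * u g * s q = u g1 * s p' * star (s q') * u g2 ;
  brel_II0 : forall p q g,
    ~ (exists p' q' g1 g2, factorization p q g p' q' g1 g2) ->
    star (s p) * u g * s q = 0 ;
  brel_III : forall p t, left_transversal (range (theta p)) t ->
    \sum_(g <- t) range_projection u s g p = 1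
}.

(* (A, u, s) is the universal C*-algebra for the above relations, i.e. a copy *)
(* of the boundary quotient together with its generators.                     *)
Record is_boundary_quotient (A : cstarAlgType R) (u : G -> A) (s : P -> A) :
    Prop := {
  bq_relations : boundary_relations u s ;
  bq_generated : cstar_generated (range u `|` range s) = setT ;
  bq_universal : forall (B : cstarAlgType R) (v : G -> B) (w : P -> B),
    boundary_relations v w ->
    exists phi : {lrmorphism A -> B},
      [/\ {morph phi : x / star x}, forall g, phi (u g) = v g &
          forall p, phi (s p) = w p]
}.

Definition diagonal_subalgebra {A : cstarAlgType R} (u : G -> A) (s : P -> A) : set A :=
  cstar_generated [set e | exists g p, e = range_projection u s g p].

End BoundaryQuotient.

(* Main.v *)
Require Import Defs.
From mathcomp Require Import all_boot all_order all_algebra.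
From mathcomp Require Import all_classical all_reals.
From mathcomp Require Import complex.
From mathcomp Require Import ring lra.

(** Write [v g p] for the isometry [u g * s p] and [e g p] for its range
    projection.  The relations make the closed span of the monomials
    [v a p * star (v b q)] the whole algebra, and the closed span of the [e g p]
    the diagonal [D], which is commutative and normalized by all [v g p].  A
    faithful conditional expectation onto [D] is given, so the substance is the
    maximality of [D].

    Let [x] lie in a commutative subalgebra that contains [D].  Then
    [y = x - Theta x] commutes with [D] and [Theta y = 0].  It suffices that
    [Theta (y * t) = 0] for all monomials [t]: by density this gives
    [Theta (y * star y) = 0], hence [y = 0] as [Theta] is faithful.  For a
    diagonal monomial [t], the bimodule property gives
    [Theta (y * t) = Theta y * t = 0].  For another one, put
    [T = Theta (y * t)], an element of [D].  Whenever a projection [e k r]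
    satisfies [e k r * t * e k r = 0], moving it past [y] gives
    [e k r * T = Theta (y * (e k r * t * e k r)) = 0].  Two facts then force
    [T = 0].

    The first is topological freeness ([monomial_compression_eq0]): below every
    range projection there is one that [t] moves off itself.  On the points of
    [G], [t] is the partial map from [b * theta q h] to [a * theta p h].  By the
    finiteness hypothesis it cannot fix a whole coset of [theta r0], unless [G]
    is finite and therefore trivial; minimality then separates a small coset of a
    moved point from its image.

    The second is that an element of [D] vanishes if sufficiently small range
    projections kill it ([diagonal_eq0]).  It reduces to the claim that a
    nonzero product of range projections and complements of such lies above some
    range projection ([boolean_piece_above]).  This is clear if the cosets
    of the complemented projections leave a point of [G] uncovered.  If they
    cover [G], those of finite index already do, by Neumann's lemma, and the
    relation for subgroups of finite index makes the product zero. *)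

Set Implicit Arguments.
Unset Strict Implicit.
Unset Printing Implicit Defensive.

Import Order.TTheory GRing.Theory Num.Theory.

Local Open Scope classical_set_scope.
Local Open Scope ring_scope.

(** * Norm, involution and closed linear spans in a C*-algebra *)

Section CStarPrelim.
Context {R : realType} {A : cstarAlgType R}.
Implicit Types (x y z : A) (B S : set A).

Lemma cnorm0 : cnorm (0 : A) = 0.
Proof. by rewrite -(scale0r (0 : A)) cnormZ normr0 mul0r. Qed.

Lemma cnormN x : cnorm (- x) = cnorm x.
Proof. by rewrite -scaleN1r cnormZ normrN normr1 mul1r. Qed.

Lemma cnorm_ge0 x : 0 <= cnorm x.
Proof. by have := cnormD_le x (- x); rewrite subrr cnorm0 cnormN => ?; lra. Qed.

Lemma star0 : star (0 : A) = 0.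
Proof. by rewrite -(scale0r (0 : A)) starZ rmorph0 !scale0r. Qed.

Lemma starN x : star (- x) = - star x.
Proof. by apply: (addIr (star x)); rewrite -starD !addNr star0. Qed.

Lemma starB x y : star (x - y) = star x - star y.
Proof. by rewrite starD starN. Qed.

Lemma star1 : star (1 : A) = 1.
Proof. by rewrite -[LHS]mul1r -{1}(starK 1) -starM mul1r starK. Qed.

Lemma cnorm_star x : cnorm (star x) = cnorm x.
Proof.
have le_star y : cnorm y <= cnorm (star y).
  have [->|y0] := eqVneq (cnorm y) 0; first exact: cnorm_ge0.
  have y_gt0 : 0 < cnorm y by rewrite lt_def y0 cnorm_ge0.
  by rewrite -(ler_pM2r y_gt0) -expr2 -cnorm_starM cnormM_le.
apply/eqP; rewrite eq_le le_star andbT.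
by have := le_star (star x); rewrite starK.
Qed.

Lemma cnorm_projection (e : A) : star e = e -> e * e = e -> e != 0 -> cnorm e = 1.
Proof.
move=> es ee e0; have ne0 : cnorm e != 0.
  by apply: contra_neq e0; exact: cnorm_eq0.
by apply: (mulfI ne0); rewrite mulr1 -expr2 -cnorm_starM es ee.
Qed.

Lemma cnorm1 : cnorm (1 : A) = 1.
Proof. by apply: cnorm_projection; rewrite ?star1 ?mulr1 ?oner_neq0. Qed.

Lemma cnorm_isometry x : star x * x = 1 -> cnorm x = 1.
Proof.
move=> xx; apply/eqP; rewrite -sqrp_eq1 ?cnorm_ge0//.
by rewrite -cnorm_starM xx cnorm1.
Qed.

Lemma idempotent_mul x y : x * y = y * x -> x * x = x -> y * y = y ->
  x * y * (x * y) = x * y.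
Proof. by move=> xy xx yy; rewrite mulrA -(mulrA x) -xy mulrA xx -mulrA yy. Qed.

Lemma cnorm_small_eq0 x : (forall e : R, 0 < e -> cnorm x <= e) -> x = 0.
Proof.
move=> small; apply: cnorm_eq0; apply/eqP; rewrite eq_le cnorm_ge0 andbT.
by apply/ler_addgt0Pr => e e0; rewrite add0r small.
Qed.

(** An element of [lspan S] comes with a list of scalars and elements of [S],
    so that proofs by induction on it peel off one summand at a time. *)
Inductive lspan S : A -> Prop :=
| lspan0 : lspan S 0
| lspan_cons c x y : S x -> lspan S y -> lspan S (c *: x + y).

Definition norm_closure B : set A :=
  [set x | forall e : R, 0 < e -> exists2 y, B y & cnorm (x - y) < e].

Lemma sub_lspan S : S `<=` lspan S.
Proof.
by move=> x Sx; rewrite -(addr0 x) -(scale1r x); apply: lspan_cons Sx _; left.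
Qed.

Lemma lspanZ S c x : lspan S x -> lspan S (c *: x).
Proof.
elim=> [|d {}x y Sx _ IH]; first by rewrite scaler0; left.
by rewrite scalerDr scalerA; right.
Qed.

Lemma lspanD S x y : lspan S x -> lspan S y -> lspan S (x + y).
Proof.
move=> + Sy; elim=> [|d {}x {}z Sx _ IH]; first by rewrite add0r.
by rewrite -addrA; right.
Qed.

Lemma lspan_linear S B (f : A -> A) : B 0 ->
  (forall x y, B x -> B y -> B (x + y)) -> (forall c x, B x -> B (c *: x)) ->
  f 0 = 0 -> (forall c x y, f (c *: x + y) = c *: f x + f y) ->
  (forall x, S x -> B (f x)) -> forall x, lspan S x -> B (f x).
Proof.
move=> B0 BD BZ f0 fP Sf x; elim=> [|c {}x y Sx _ IH]; first by rewrite f0.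
by rewrite fP; apply: BD => //; apply: BZ; exact: Sf.
Qed.

Lemma sub_closure B : B `<=` norm_closure B.
Proof. by move=> x Bx e e0; exists x; rewrite ?subrr ?cnorm0. Qed.

Lemma closure_closed B : norm_closed (norm_closure B).
Proof.
move=> x xP e e0; have e2 : 0 < e / 2 by lra.
have [y By yP] := xP _ e2; have [z Bz zP] := By _ e2; exists z => //.
rewrite -(subrKA y); apply: le_lt_trans (cnormD_le _ _) _.
lra.
Qed.

Lemma set0_closed : norm_closed [set (0 : A)].
Proof.
move=> x xP; apply: cnorm_small_eq0 => e /xP[_ ->]; rewrite subr0.
exact: ltW.
Qed.

Lemma closure_bounded B C (f : A -> A) (K : R) :
  (forall x y, f (x - y) = f x - f y) ->
  (forall x, cnorm (f x) <= K * cnorm x) ->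
  norm_closed C -> (forall x, B x -> C (f x)) ->
  forall x, norm_closure B x -> C (f x).
Proof.
move=> fB fK Ccl BC x xP; apply: Ccl => e e0.
have K0 : 0 < `|K| + 1 by rewrite ltr_wpDl.
have [y By yP] := xP (e / (`|K| + 1)) (divr_gt0 e0 K0).
exists (f y); first exact: BC.
rewrite -fB; apply: le_lt_trans (fK _) _.
move: yP; rewrite ltr_pdivlMr// mulrC; apply: le_lt_trans.
by rewrite ler_wpM2r ?cnorm_ge0// ler_wpDr// ler_norm.
Qed.

Lemma closure_mul B C a b : norm_closed C ->
  (forall x, B x -> C (a * x * b)) ->
  forall x, norm_closure B x -> C (a * x * b).
Proof.
apply: (@closure_bounded _ _ (fun x => a * x * b) (cnorm a * cnorm b)).
  by move=> x y; rewrite mulrBr mulrBl.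
move=> x; rewrite mulrAC; apply: le_trans (cnormM_le _ _) _.
by rewrite ler_wpM2r ?cnorm_ge0 ?cnormM_le.
Qed.

Lemma closed_lspan_cstar S :
  (forall x y, S x -> S y -> lspan S (x * y)) ->
  (forall x, S x -> lspan S (star x)) ->
  cstar_subalgebra (norm_closure (lspan S)).
Proof.
move=> SM Sstar.
have spanM x y : lspan S x -> lspan S y -> lspan S (x * y).
  move=> Sx Sy; move: x Sx; apply: (lspan_linear (f := fun x => x * y)).
  - by left.
  - exact: lspanD.
  - exact: lspanZ.
  - exact: mul0r.
  - by move=> c x z; rewrite mulrDl scalerAl.
  move=> x Sx; move: y Sy; apply: (lspan_linear (f := fun y => x * y)).
  - by left.
  - exact: lspanD.
  - exact: lspanZ.
  - exact: mulr0.
  - by move=> c y z; rewrite mulrDr scalerAr.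
  by move=> y Sy; exact: SM.
have clD x y : norm_closure (lspan S) x -> norm_closure (lspan S) y ->
    norm_closure (lspan S) (x + y).
  move=> xP yP e e0; have e2 : 0 < e / 2 by lra.
  have [x' Sx' xx'] := xP _ e2; have [y' Sy' yy'] := yP _ e2.
  exists (x' + y'); first exact: lspanD.
  rewrite opprD addrACA; apply: le_lt_trans (cnormD_le _ _) _.
  lra.
split.
- by apply: sub_closure; left.
- exact: clD.
- move=> c; apply: (closure_bounded (f := fun x => c *: x)).
  + by move=> x y; rewrite scalerBr.
  + by move=> x; rewrite cnormZ.
  + exact: closure_closed.
  by move=> x Sx; apply: sub_closure; exact: lspanZ.
- move=> x y Sx Sy; rewrite -[x]mul1r; apply: (closure_mul _ _ Sx).
    exact: closure_closed.
  move=> {Sx}x Sx; rewrite mul1r -[_ * y]mulr1; apply: (closure_mul _ _ Sy).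
    exact: closure_closed.
  by move=> z Sz; rewrite mulr1; apply: sub_closure; exact: spanM.
- apply: (closure_bounded (f := star) (K := 1)).
  + exact: starB.
  + by move=> x; rewrite cnorm_star mul1r.
  + exact: closure_closed.
  move=> x Sx; apply: sub_closure; elim: Sx => [|c {}x y Sx _ IH].
    by rewrite star0; left.
  rewrite starD starZ; apply: lspanD => //; apply: lspanZ.
  exact: Sstar.
- exact: closure_closed.
Qed.

Lemma cstar_generated_sub S : S `<=` cstar_generated S.
Proof. by move=> x Sx B [_]; apply. Qed.

Lemma cstar_generated_min S B : cstar_subalgebra B -> S `<=` B ->
  cstar_generated S `<=` B.
Proof. by move=> algB SB x; apply; split. Qed.

Lemma cstar_generated_cstar S : cstar_subalgebra (cstar_generated S).
Proof.
split.
- by move=> B [[]].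
- move=> x y Sx Sy B [algB SB].
  by apply: (cstar_subalgebraD algB); [exact: Sx|exact: Sy].
- by move=> c x Sx B [algB SB]; apply: (cstar_subalgebraZ algB); exact: Sx.
- move=> x y Sx Sy B [algB SB].
  by apply: (cstar_subalgebraM algB); [exact: Sx|exact: Sy].
- by move=> x Sx B [algB SB]; apply: (cstar_subalgebra_star algB); exact: Sx.
- move=> x xP B [algB SB]; apply: (cstar_subalgebra_closed algB) => e e0.
  by have [y yP yx] := xP e e0; exists y => //; exact: yP.
Qed.

(** The chord of the circle of radius [M] that is perpendicular at [c] to the
    ray through [c] has [c] as its midpoint.  Applied to coefficients, this
    turns a combination of orthogonal projections into an average of two
    elements whose norms follow from the C*-identity alone. *)
Lemma unimodular_midpoint (M : R) (c : R[i]) :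
  0 < M -> complex.Re `|c| <= M ->
  exists z z' : R[i], [/\ z^* * z = 1, z'^* * z' = 1 &
    c = (M / 2)%:C%C * (z + z')].
Proof.
move=> M0 cM; have MC0 : M%:C%C != 0 :> R[i].
  by rewrite eq_complex /= eqxx andbT gt_eqF.
pose d : R[i] := c / M%:C%C; pose r : R[i] := `|d|.
have r0 : 0 <= r by exact: normr_ge0.
have r1 : r <= 1.
  rewrite /r normrM normfV ler_pdivrMr ?normr_gt0// mul1r.
  rewrite -[`|c|]RRe_real ?normr_real// -[`|M%:C%C|]RRe_real ?normr_real//.
  rewrite lecR (le_trans cM)// normc_def /= expr0n addr0 sqrtr_sqr.
  exact: ler_norm.
pose w := if d == 0 then 1 else d / r.
have wP : `|w| = 1.
  rewrite /w; case: eqVneq => [_|dn0]; first exact: normr1.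
  by rewrite normrM normfV normr_id divff// normr_eq0.
have dE : d = w * r.
  rewrite /w; case: eqVneq => [d0|dn0]; first by rewrite /r d0 normr0 mulr0.
  by rewrite divfK// /r normr_eq0.
pose k := sqrtC (1 - r ^+ 2).
have k0 : 0 <= k by rewrite sqrtC_ge0 subr_ge0 expr_le1.
have unim (v : R[i]) : `|v| ^+ 2 = 1 -> (w * v)^* * (w * v) = 1.
  by move=> v1; rewrite mulrC -sqr_normc normrM wP mul1r.
have norm_rk (e : R[i]) : e \is Num.real -> e ^+ 2 = 1 - r ^+ 2 ->
    `|r + 'i%R * e| ^+ 2 = 1.
  by move=> er ee; rewrite normC2_rect ?(ger0_real r0) // ee addrC subrK.
exists (w * (r + 'i%R * k)), (w * (r + 'i%R * - k)); split.
- by apply: unim; apply: norm_rk; rewrite ?ger0_real ?sqrtCK.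
- by apply: unim; apply: norm_rk; rewrite ?rpredN ?ger0_real ?sqrrN ?sqrtCK.
have -> : c = M%:C%C * d by rewrite mulrC divfK.
rewrite dE rmorphM fmorphV /= rmorph_nat.
have two : (2 : R[i]) != 0 by rewrite pnatr_eq0.
by field.
Qed.

End CStarPrelim.

(** * Finite index and finite coverings by cosets *)

Section Cosets.
Context {G : groupType}.
Implicit Types (H K : set G) (g h : G).

Definition is_subgroup H : Prop :=
  H 1%g /\ forall x y, H x -> H y -> H (x^-1 * y)%g.

Lemma subgroupV H x : is_subgroup H -> H x -> H (x^-1)%g.
Proof. by case=> H1 HB Hx; rewrite -[_^-1%g]mulg1; exact: HB. Qed.

Lemma subgroupM H x y : is_subgroup H -> H x -> H y -> H (x * y)%g.
Proof.
move=> Hgrp Hx Hy; rewrite -(invgK x).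
by apply: Hgrp.2 => //; exact: subgroupV.
Qed.

Definition finite_index H : Prop :=
  exists t : seq G, forall g, exists2 h, h \in t & H (h^-1 * g)%g.

Lemma finite_indexI H K : is_subgroup H -> is_subgroup K ->
  finite_index H -> finite_index K -> finite_index (H `&` K).
Proof.
move=> Hgrp Kgrp [tH tHP] [tK tKP].
pose common a b := xget 1%g [set x | H (a^-1 * x)%g /\ K (b^-1 * x)%g].
exists [seq common a b | a <- tH, b <- tK] => g.
have [a at_ Ha] := tHP g; have [b bt Kb] := tKP g.
exists (common a b); first by apply/allpairsP; exists (a, b).
have [ha kb] : [set x | H (a^-1 * x)%g /\ K (b^-1 * x)%g] (common a b).
  by apply: (@xgetPex _ 1%g); exists g.
split.
  by have := Hgrp.2 _ _ ha Ha; rewrite invgM invgK -mulgA mulVKg.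
by have := Kgrp.2 _ _ kb Kb; rewrite invgM invgK -mulgA mulVKg.
Qed.

(** Choosing one representative in each coset turns a finite family of cosets
    that covers the group into an irredundant one. *)
Lemma finite_index_transversal H : is_subgroup H -> finite_index H ->
  exists t, left_transversal H t.
Proof.
move=> Hgrp [t tP].
pose coset g := [set h : G | H (h^-1 * g)%g].
pose rep g := xget 1%g (coset g).
have repP g : coset g (rep g).
  by apply: (@xgetPex _ 1%g); exists g; rewrite /coset /= mulVg; exact: Hgrp.1.
have coset_eq g h : H (h^-1 * g)%g -> coset g = coset h.
  move=> Hhg; apply/seteqP; split=> x; rewrite /coset /= => Hx.
    have := subgroupM Hgrp Hx (subgroupV Hgrp Hhg).
    by rewrite invgM invgK -mulgA mulVKg.
  by have := subgroupM Hgrp Hx Hhg; rewrite -mulgA mulVKg.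
exists (undup [seq rep h | h <- t]); split; first exact: undup_uniq.
move=> g; exists (rep g); split.
  split; last exact: repP.
  rewrite mem_undup; have [h ht Hhg] := tP g.
  by rewrite /rep (coset_eq _ _ Hhg); apply/mapP; exists h.
move=> h'; rewrite mem_undup => -[/mapP[h ht ->] Hh'].
rewrite /rep; congr (xget _ _).
by rewrite (coset_eq _ _ Hh') (coset_eq _ _ (repP h)).
Qed.

(** This is B. H. Neumann's lemma.  If the listed cosets of the first subgroup
    [H] do not cover the group, then they miss a whole coset of [H], which the
    other cosets have to cover; its translates are all the cosets of [H], so [H]
    can be dispensed with. *)
Lemma neumann_finite_index (I : eqType) (H : I -> set G) (s : seq I) :
  (forall i, is_subgroup (H i)) ->
  forall L : seq (G * I), (forall x, x \in L -> x.2 \in s) ->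
  (forall g, exists2 x, x \in L & H x.2 (x.1^-1 * g)%g) ->
  exists2 i, i \in s & finite_index (H i).
Proof.
move=> Hgrp; elim: s => [|i s IH] L Ls cover.
  by have [x /Ls] := cover 1%g.
have [coveri|] := pselect (forall g,
    exists2 x, x \in [seq x <- L | x.2 == i] & H i (x.1^-1 * g)%g).
  exists i; first exact: mem_head.
  exists [seq x.1 | x <- L & x.2 == i] => g; have [x xL Hx] := coveri g.
  by exists x.1 => //; apply/mapP; exists x.
move=> /existsNP[g0 miss].
pose rest := [seq x <- L | x.2 != i].
have cover_g0 h : H i h -> exists2 y, y \in rest & H y.2 (y.1^-1 * (g0 * h))%g.
  move=> Hh; have [y yL Hy] := cover (g0 * h)%g; exists y => //.
  rewrite mem_filter yL andbT; apply/eqP => yi; apply: miss; exists y.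
    by rewrite mem_filter yi eqxx.
  rewrite yi in Hy; have := subgroupM (Hgrp i) Hy (subgroupV (Hgrp i) Hh).
  by rewrite -!mulgA mulgV mulg1.
pose L' := rest ++ [seq ((x.1 * g0^-1 * y.1)%g, y.2) |
                     x <- [seq x <- L | x.2 == i], y <- rest].
have [||j js Hj] := IH L'; last by exists j => //; rewrite inE js orbT.
- have rest_s x : x \in rest -> x.2 \in s.
    rewrite mem_filter => /andP[xi /Ls]; rewrite inE => /orP[/eqP x2|//].
    by rewrite x2 eqxx in xi.
  move=> x; rewrite mem_cat => /orP[/rest_s//|/allpairsP[[a b] /= [_ bP ->]]].
  exact: (rest_s b bP).
- move=> g; have [x xL Hx] := cover g.
  have [xi|xi] := eqVneq x.2 i; last first.
    by exists x => //; rewrite mem_cat mem_filter xi xL.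
  rewrite xi in Hx; have [y yr Hy] := cover_g0 _ Hx.
  exists ((x.1 * g0^-1 * y.1)%g, y.2).
    rewrite mem_cat; apply/orP; right; apply/allpairsP; exists (x, y).
    by split => //=; rewrite mem_filter xi eqxx.
  by move: Hy; rewrite /= !invgM invgK !mulgA.
Qed.

End Cosets.

(** * The isometries of the semidirect product and their range projections *)

Section BoundaryRelations.
Context {R : realType} {G : groupType} {P : monoidType}.
Context {theta : P -> {multiplicative G -> G}}.
Hypothesis Hads : algebraic_dynamical_system theta.
Hypothesis Hdirected : directed_monoid P.

Lemma theta_one p : theta p 1%g = 1%g.
Proof. by apply: (mulgI (theta p 1%g)); rewrite -gmulfM !mulg1. Qed.

Lemma theta_inv p g : theta p (g^-1)%g = (theta p g)^-1%g.
Proof. by apply: (mulgI (theta p g)); rewrite -gmulfM !mulgV theta_one. Qed.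

Lemma range_theta_subgroup p : is_subgroup (range (theta p)).
Proof.
split; first by exists 1%g => //; exact: theta_one.
by move=> _ _ [x _ <-] [y _ <-]; exists (x^-1 * y)%g; rewrite // gmulfM theta_inv.
Qed.

Lemma least_common_multiple (p q : P) : exists x y, (p * x = q * y)%g /\
  right_ideal p `&` right_ideal q = right_ideal (p * x)%g.
Proof.
have [/seteqP[none _]|[r rE]] := ads_right_LCM Hads p q.
  by have [z /none] := Hdirected p q.
have : right_ideal r r by exists 1%g; rewrite // mulg1.
by rewrite -rE => -[[x _ xr] [y _ yr]]; exists x, y; rewrite xr yr.
Qed.

Lemma common_multiple (l : seq P) :
  exists r, forall p, p \in l -> exists x, r = (p * x)%g.
Proof.
elim: l => [|p l [r rP]]; first by exists 1%g.
have [x [y [xy _]]] := least_common_multiple p r.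
exists (p * x)%g => q; rewrite inE => /predU1P[->|/rP[z rz]]; first by exists x.
by exists (z * y)%g; rewrite xy rz mulgA.
Qed.

(** Least common multiples turn into intersections of images, so finiteness of
    the index survives. *)
Lemma finite_index_common_multiple (l : seq P) :
  (forall p, p \in l -> finite_index (range (theta p))) ->
  exists2 r, finite_index (range (theta r)) &
    forall p, p \in l -> exists x, r = (p * x)%g.
Proof.
elim: l => [|p l IH] fin.
  exists 1%g => //; exists [:: 1%g] => g; exists 1%g; rewrite ?mem_seq1//.
  by exists g; rewrite // (ads_theta1 Hads) invg1 mul1g.
have [|r rfin rP] := IH; first by move=> q ql; apply: fin; rewrite inE ql orbT.
have [x [y [xy xI]]] := least_common_multiple p r.
exists (p * x)%g.
  rewrite -(ads_order Hads xI).
  apply: finite_indexI => //; try exact: range_theta_subgroup.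
  by apply: fin; exact: mem_head.
move=> q; rewrite inE => /predU1P[->|/rP[z rz]]; first by exists x.
by exists (z * y)%g; rewrite xy rz mulgA.
Qed.

Context {A : cstarAlgType R} {u : G -> A} {s : P -> A}.
Hypothesis Hrel : boundary_relations theta u s.

Local Notation e := (range_projection u s).

(** The isometries of the semidirect product semigroup of [G] by [P], whose
    law [semidirect_isometryM] expresses.  They are locked, because otherwise
    rewriting with associativity would split them. *)
Definition semidirect_isometry g p : A := locked (u g * s p).
Local Notation v := semidirect_isometry.

Lemma u1 : u 1%g = 1.
Proof.
have [uu _] := brel_unitary Hrel 1%g.
by rewrite -[LHS]mul1r -{1}uu -mulrA -(brel_uM Hrel) mulg1.
Qed.

Lemma star_u g : star (u g) = u (g^-1)%g.
Proof.
have [uu _] := brel_unitary Hrel g.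
by rewrite -[RHS]mul1r -uu -mulrA -(brel_uM Hrel) mulgV u1 mulr1.
Qed.

Lemma u_isometryE g : u g = v g 1%g.
Proof. by rewrite /v -!lock (brel_s1 Hrel) mulr1. Qed.

Lemma s_isometryE p : s p = v 1%g p.
Proof. by rewrite /v -!lock u1 mul1r. Qed.

Lemma semidirect_isometryM g p h q :
  v g p * v h q = v (g * theta p h)%g (p * q)%g.
Proof.
rewrite /v -!lock (brel_uM Hrel) (brel_sM Hrel) -!mulrA; congr (_ * _).
by rewrite !mulrA (brel_I Hrel).
Qed.

Lemma semidirect_isometryV g p : star (v g p) * v g p = 1.
Proof.
rewrite /v -!lock starM -mulrA (mulrA (star (u g))) (brel_unitary Hrel g).1 mul1r.
exact: brel_isometry Hrel p.
Qed.

Lemma range_projectionE g p : e g p = v g p * star (v g p).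
Proof. by rewrite /range_projection /v -!lock starM !mulrA. Qed.

Lemma isometry_starM k r g p :
  (exists g1 g2 x y, [/\ (k * theta r g1 = g * theta p g2)%g,
     (r * x = p * y)%g & star (v k r) * v g p = v g1 x * star (v g2 y)]) \/
  (forall g1 g2, (k * theta r g1)%g <> (g * theta p g2)%g) /\
  star (v k r) * v g p = 0.
Proof.
have -> : star (v k r) * v g p = star (s r) * u (k^-1 * g)%g * s p.
  by rewrite /v -!lock starM star_u (brel_uM Hrel) !mulrA.
have [[g1 [g2 kg]]|nkg] :=
  pselect (exists g1 g2, (k * theta r g1 = g * theta p g2)%g); last first.
  right; split; first by move=> g1 g2 kg; apply: nkg; exists g1, g2.
  apply: (brel_II0 Hrel) => -[p' [q' [g1 [g2 [gE _ _]]]]]; apply: nkg.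
  exists g1, (g2^-1)%g; rewrite theta_inv; apply: (mulIg (theta p g2)).
  by rewrite mulgVK -mulgA -gE mulVKg.
have [x [y [xy xI]]] := least_common_multiple r p.
left; exists g1, g2, x, y; split=> //.
rewrite (brel_II Hrel (p' := x) (q' := y) (g1 := g1) (g2 := (g2^-1)%g)).
  by rewrite /v -!lock starM star_u !mulrA.
split=> //; rewrite theta_inv; apply: (mulgI k); rewrite mulVKg mulgA kg.
by rewrite mulgK.
Qed.

Lemma star_projection g p : star (e g p) = e g p.
Proof. by rewrite range_projectionE starM starK. Qed.

Lemma isometry_projection g p h q :
  v g p * e h q * star (v g p) = e (g * theta p h)%g (p * q)%g.
Proof.
by rewrite !range_projectionE -semidirect_isometryM starM !mulrA.
Qed.

Lemma projection_isometry g p h q :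
  (exists k r, star (v g p) * e h q * v g p = e k r) \/
  star (v g p) * e h q * v g p = 0.
Proof.
have -> : star (v g p) * e h q * v g p =
    (star (v g p) * v h q) * star (star (v g p) * v h q).
  by rewrite range_projectionE starM starK !mulrA.
have [[g1 [g2 [x [y [_ _ ->]]]]]|[_ ->]] := isometry_starM g p h q; last first.
  by right; rewrite mul0r.
left; exists g1, x.
rewrite starM starK mulrA -(mulrA (v g1 x)) semidirect_isometryV mulr1.
by rewrite range_projectionE.
Qed.

Lemma projectionM g p h q :
  (exists k r, e g p * e h q = e k r) \/ e g p * e h q = 0.
Proof.
have -> : e g p * e h q = v g p * (star (v g p) * v h q) * star (v h q).
  by rewrite !range_projectionE !mulrA.
have [[g1 [g2 [x [y [gh pq ->]]]]]|[_ ->]] := isometry_starM g p h q; last first.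
  by right; rewrite mulr0 mul0r.
left; exists (g * theta p g1)%g, (p * x)%g.
rewrite mulrA semidirect_isometryM -mulrA -starM semidirect_isometryM gh pq.
by rewrite range_projectionE.
Qed.

Lemma projection_id g p : e g p * e g p = e g p.
Proof.
rewrite range_projectionE mulrA -(mulrA (v g p)) semidirect_isometryV.
by rewrite mulr1.
Qed.

Lemma projection_comm g p h q : e g p * e h q = e h q * e g p.
Proof.
rewrite -[RHS]starK starM !star_projection.
have [[k [r ->]]|->] := projectionM g p h q; first by rewrite star_projection.
by rewrite star0.
Qed.

Lemma projection_neq0 g p : e g p != 0.
Proof.
apply/eqP => e0.
have : star (v g p) * e g p * v g p = 1.
  rewrite range_projectionE !mulrA semidirect_isometryV mul1r.
  exact: semidirect_isometryV.
by rewrite e0 mulr0 mul0r => /esym/eqP; rewrite oner_eq0.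
Qed.

Lemma projection_below k r g p x : (r = p * x)%g ->
  range (theta p) (g^-1 * k)%g -> e k r * e g p = e k r.
Proof.
move=> -> [h _ hE]; have -> : k = (g * theta p h)%g by rewrite hE mulVKg.
rewrite projection_comm -isometry_projection range_projectionE !mulrA.
by rewrite -(mulrA (v g p)) semidirect_isometryV mulr1.
Qed.

Lemma projection_disjoint k r g p :
  (forall g1 g2, (k * theta r g1)%g <> (g * theta p g2)%g) ->
  e k r * e g p = 0.
Proof.
move=> disj; rewrite !range_projectionE mulrA -(mulrA (v k r)).
have [[g1 [g2 [x [y [kg _ _]]]]]|[_ ->]] := isometry_starM k r g p.
  by case: (disj g1 g2).
by rewrite mulr0 mul0r.
Qed.

Lemma projection_off k r g p x : (r = p * x)%g ->
  ~ range (theta p) (g^-1 * k)%g -> e k r * e g p = 0.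
Proof.
move=> rE nk; apply: projection_disjoint => g1 g2 kg; apply: nk.
exists (g2 * (theta x g1)^-1)%g => //.
rewrite gmulfM theta_inv -(ads_thetaM Hads) -rE.
by apply: (mulgI g); rewrite mulVKg mulgA -kg mulgK.
Qed.

Lemma monomialM a p b q a' p' b' q' :
  (exists c r d w, v a p * star (v b q) * (v a' p' * star (v b' q')) =
     v c r * star (v d w)) \/
  v a p * star (v b q) * (v a' p' * star (v b' q')) = 0.
Proof.
rewrite mulrA -(mulrA (v a p)).
have [[g1 [g2 [x [y [_ _ ->]]]]]|[_ ->]] := isometry_starM b q a' p'; last first.
  by right; rewrite mulr0 mul0r.
left; exists (a * theta p g1)%g, (p * x)%g, (b' * theta q' g2)%g, (q' * y)%g.
by rewrite -!semidirect_isometryM starM !mulrA.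
Qed.

(** * Nonzero products of range projections and of their complements *)

Definition complement (l : seq (G * P)) : A := \prod_(x <- l) (1 - e x.1 x.2).

Lemma complement_cons x l :
  complement (x :: l) = (1 - e x.1 x.2) * complement l.
Proof. by rewrite /complement big_cons. Qed.

Lemma complement_comm g p l : e g p * complement l = complement l * e g p.
Proof.
rewrite /complement; elim/big_rec: _ => [|x c _ IH]; first by rewrite mulr1 mul1r.
have step : e g p * (1 - e x.1 x.2) = (1 - e x.1 x.2) * e g p.
  by rewrite mulrBr mulrBl mulr1 mul1r projection_comm.
by rewrite mulrA step -mulrA IH mulrA.
Qed.

Lemma complement_commC g p l :
  (1 - e g p) * complement l = complement l * (1 - e g p).
Proof. by rewrite mulrBl mulrBr mul1r mulr1 complement_comm. Qed.

Lemma complementP l :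
  star (complement l) = complement l /\ complement l * complement l = complement l.
Proof.
elim: l => [|x l [IHs IHid]]; first by rewrite /complement big_nil star1 mulr1.
rewrite complement_cons; split.
  by rewrite starM starB star1 star_projection IHs complement_commC.
apply: idempotent_mul => //; first exact: complement_commC.
by rewrite mulrBr mulr1 mulrBl mul1r projection_id subrr subr0.
Qed.

(** The reduction of the part of a complement below one range projection to a
    complement in the whole group. *)
Lemma isometry_complement g p l :
  exists l', star (v g p) * complement l = complement l' * star (v g p).
Proof.
elim: l => [|x l [l' IH]].
  by exists [::]; rewrite /complement !big_nil mulr1 mul1r.
have step : star (v g p) * e x.1 x.2 =
    star (v g p) * e x.1 x.2 * v g p * star (v g p).
  rewrite -(mulrA _ (v g p)) -range_projectionE -mulrA projection_comm mulrA.
  by rewrite (range_projectionE g) (mulrA (star _)) semidirect_isometryV mul1r.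
have -> : star (v g p) * complement (x :: l) =
    (1 - star (v g p) * e x.1 x.2 * v g p) * (complement l' * star (v g p)).
  rewrite complement_cons; move: (e x.1 x.2) step => E step.
  by rewrite mulrA mulrBr mulr1 -IH mulrA !mulrBl mul1r -step.
have [[k [r ->]]|->] := projection_isometry g p x.1 x.2; last first.
  by exists l'; rewrite subr0 mul1r.
by exists ((k, r) :: l'); rewrite complement_cons mulrA.
Qed.

Lemma complement_below k r l :
  (forall x, x \in l -> e k r * e x.1 x.2 = 0) -> e k r * complement l = e k r.
Proof.
elim: l => [|x l IH] l0; first by rewrite /complement big_nil mulr1.
rewrite complement_cons mulrA mulrBr mulr1 l0 ?mem_head// subr0 IH// => y yl.
by apply: l0; rewrite inE yl orbT.
Qed.

Lemma complement_above k r x l : x \in l -> e k r * e x.1 x.2 = e k r ->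
  e k r * complement l = 0.
Proof.
elim: l => [//|y l IH]; rewrite inE => /predU1P[-> kx|xl kx].
  by rewrite complement_cons mulrA mulrBr mulr1 kx subrr mul0r.
by rewrite complement_cons complement_commC mulrA IH// mul0r.
Qed.

(** If some point [k] of [G] lies in none of the cosets of the list, then a
    coset of [k] deep enough avoids them all.  Otherwise they cover [G]; by
    Neumann's lemma those of finite index do too, and the relation that sums
    range projections over a transversal makes the complement vanish. *)
Lemma complement_eq0_or_above l :
  complement l = 0 \/ exists k r, e k r * complement l = e k r.
Proof.
have [[k kP]|cover] := pselect (exists k, forall x, x \in l ->
    ~ range (theta x.2) (x.1^-1 * k)%g).
  have [r rP] := common_multiple [seq x.2 | x <- l].
  right; exists k, r; apply: complement_below => x xl.
  have [z rz] : exists z, (r = x.2 * z)%g by apply: rP; exact: map_f.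
  by apply: projection_off rz _; exact: kP.
left; pose fin p := `[< finite_index (range (theta p)) >].
have [|r rfin rP] := @finite_index_common_multiple [seq x.2 | x <- l & fin x.2].
  by move=> _ /mapP[x + ->]; rewrite mem_filter => /andP[/asboolP].
have [t tP] := finite_index_transversal (range_theta_subgroup r) rfin.
have fin_cover k : exists x, [/\ x \in l, fin x.2 &
    range (theta x.2) (x.1^-1 * k)%g].
  apply: contrapT => nk.
  pose inf := [seq x <- l | ~~ fin x.2].
  have inf_cover h : range (theta r) h ->
      exists2 x, x \in inf & range (theta x.2) (x.1^-1 * (k * h))%g.
    move=> rh; have [x xl xkh] : exists2 x, x \in l &
        range (theta x.2) (x.1^-1 * (k * h))%g.
      apply: contrapT => nkh; apply: cover; exists (k * h)%g => x xl xkh.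
      by apply: nkh; exists x.
    exists x => //; rewrite mem_filter xl andbT; apply/negP => xfin.
    apply: nk; exists x; split=> //.
    have [z rz] : exists z, (r = x.2 * z)%g.
      by apply: rP; apply: map_f; rewrite mem_filter xfin.
    have xh : range (theta x.2) h.
      by case: rh => h' _ <-; exists (theta z h'); rewrite // rz (ads_thetaM Hads).
    have gx := range_theta_subgroup x.2.
    have := subgroupM gx xkh (subgroupV gx xh).
    by rewrite -!mulgA mulgV mulg1.
  (* The translates to all of [G] of the covering of the coset of [k]. *)
  pose L := [seq ((h * k^-1 * x.1)%g, x.2) | h <- t, x <- inf].
  have [||p pinf pfin] := @neumann_finite_index G P (fun p => range (theta p))
    [seq x.2 | x <- inf] range_theta_subgroup L.
  - by move=> _ /allpairsP[[h x] /= [_ xl ->]]; exact: (map_f snd xl).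
  - move=> g; have [h [[ht hg] _]] := tP.2 g.
    have [x xl xP] := inf_cover _ hg.
    exists ((h * k^-1 * x.1)%g, x.2).
      by apply/allpairsP; exists (h, x).
    by move: xP; rewrite /= !invgM invgK !mulgA.
  have /mapP[x] := pinf; rewrite mem_filter => /andP[/negP nfin _] px.
  by apply: nfin; apply/asboolP; rewrite -px.
rewrite -[LHS]mul1r -(brel_III Hrel tP) mulr_suml big1// => k _.
have [x [xl xfin xk]] := fin_cover k.
have [z rz] : exists z, (r = x.2 * z)%g.
  by apply: rP; apply: map_f; rewrite mem_filter xfin.
by apply: complement_above xl _; exact: projection_below rz xk.
Qed.

(** One uncomplemented factor is enough to make the pieces stable under
    multiplication by range projections and their complements, because a product
    of range projections is a range projection or zero. *)
Inductive boolean_piece : A -> Prop :=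
| boolean_piece0 : boolean_piece 0
| boolean_piece_complement g p l : boolean_piece (e g p * complement l).

Lemma boolean_piece1 : boolean_piece 1.
Proof.
have -> : 1 = e 1%g 1%g * complement [::]; last by right.
rewrite /complement big_nil mulr1 /range_projection u1 (brel_s1 Hrel).
by rewrite !star1 !mulr1.
Qed.

Lemma boolean_piece_comm f g p : boolean_piece f -> f * e g p = e g p * f.
Proof.
case=> [|h q l]; first by rewrite mulr0 mul0r.
by rewrite -mulrA -complement_comm mulrA projection_comm -mulrA.
Qed.

Lemma boolean_pieceP f : boolean_piece f -> star f = f /\ f * f = f.
Proof.
case=> [|h q l]; first by rewrite star0 mulr0.
have [cs cid] := complementP l; split.
  by rewrite starM star_projection cs complement_comm.
apply: idempotent_mul => //; first exact: complement_comm.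
exact: projection_id.
Qed.

Lemma boolean_pieceM f g p : boolean_piece f -> boolean_piece (f * e g p).
Proof.
case=> [|h q l]; first by rewrite mul0r; left.
rewrite -mulrA -complement_comm mulrA.
have [[k [r ->]]|->] := projectionM h q g p; first by right.
by rewrite mul0r; left.
Qed.

Lemma boolean_pieceB f g p : boolean_piece f -> boolean_piece (f * (1 - e g p)).
Proof.
case=> [|h q l]; first by rewrite mul0r; left.
by rewrite -mulrA -complement_commC -(complement_cons (g, p)); right.
Qed.

Lemma boolean_piece_above f : boolean_piece f -> f != 0 ->
  exists k r, e k r * f = e k r.
Proof.
case=> [|g p l]; rewrite ?eqxx// => f0.
have [l' l'P] := isometry_complement g p l.
have fE : e g p * complement l = v g p * complement l' * star (v g p).
  by rewrite range_projectionE -!mulrA l'P.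
have [l'0|[k [r kr]]] := complement_eq0_or_above l'.
  by case/eqP: f0; rewrite fE l'0 mulr0 mul0r.
exists (g * theta p k)%g, (p * r)%g.
rewrite -isometry_projection fE; move: (e k r) kr => E kr.
rewrite !mulrA -(mulrA (v g p * _)).
by rewrite semidirect_isometryV mulr1 -(mulrA (v g p)) kr.
Qed.

(** * Elements of the diagonal are tested on small range projections *)

Definition range_projections : set A := [set x | exists g p, x = e g p].
Local Notation D := (diagonal_subalgebra u s).

Lemma projection_diagonal g p : D (e g p).
Proof. by apply: cstar_generated_sub; exists g, p. Qed.

Lemma diagonal_cstar : cstar_subalgebra D.
Proof. exact: cstar_generated_cstar. Qed.

Lemma diagonal1 : D 1.
Proof.
have -> : 1 = e 1%g 1%g; last exact: projection_diagonal.
by rewrite /range_projection u1 (brel_s1 Hrel) !star1 !mulr1.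
Qed.

Lemma diagonal_closed_span : D `<=` norm_closure (lspan range_projections).
Proof.
apply: cstar_generated_min; last first.
  by move=> x Ex; apply: sub_closure; exact: sub_lspan.
apply: closed_lspan_cstar => [x y [g [p ->]] [h [q ->]]|x [g [p ->]]].
  have [[k [r ->]]|->] := projectionM g p h q; last by left.
  by apply: sub_lspan; exists k, r.
by rewrite star_projection; apply: sub_lspan; exists g, p.
Qed.

Lemma diagonal_abelian : abelian_set D.
Proof.
have comm a x : D x -> (forall g p, a * e g p = e g p * a) -> a * x = x * a.
  move=> /diagonal_closed_span Dx ae; apply/eqP; rewrite -subr_eq0; apply/eqP.
  move: x Dx; apply: (closure_bounded (C := [set 0]) (f := fun x => a * x - x * a)
                       (K := cnorm a + cnorm a)).
  - move=> x y; rewrite mulrBr mulrBl !opprB addrACA [RHS]addrACA.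
    by congr (_ + _); rewrite addrC.
  - move=> x; apply: le_trans (cnormD_le _ _) _.
    rewrite cnormN mulrDl lerD ?cnormM_le// mulrC; exact: cnormM_le.
  - exact: set0_closed.
  apply: (lspan_linear (B := [set 0]) (f := fun x => a * x - x * a)).
  - by [].
  - by move=> x y -> ->; rewrite addr0.
  - by move=> c x ->; rewrite scaler0.
  - by rewrite mulr0 mul0r subrr.
  - move=> c x y; rewrite mulrDr mulrDl -scalerAr -scalerAl scalerBr.
    by rewrite opprD addrACA.
  by move=> _ [g [p ->]]; rewrite ae subrr.
move=> x y Dx Dy; apply: (comm) => // g p; apply/esym; apply: (comm) => // h q.
exact: projection_comm.
Qed.

Lemma isometry_normalizes g p : cstar_normalizer D (v g p).
Proof.
have Dcl := cstar_subalgebra_closed diagonal_cstar.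
have conj a b : (forall h q, D (a * e h q * b)) -> forall x, D x -> D (a * x * b).
  move=> De x /diagonal_closed_span; apply: closure_mul => //.
  apply: (lspan_linear (f := fun x => a * x * b)).
  - exact: cstar_subalgebra0 diagonal_cstar.
  - exact: cstar_subalgebraD diagonal_cstar.
  - exact: cstar_subalgebraZ diagonal_cstar.
  - by rewrite mulr0 mul0r.
  - by move=> c y z; rewrite mulrDr mulrDl -scalerAr -scalerAl.
  by move=> _ [h [q ->]].
split; apply: conj => h q.
  by rewrite isometry_projection; exact: projection_diagonal.
have [[k [r ->]]|->] := projection_isometry g p h q.
  exact: projection_diagonal.
exact: cstar_subalgebra0 diagonal_cstar.
Qed.

(** The pieces cut the span of finitely many range projections into scalars.
    Writing these scalars as midpoints of points of a circle, we get an average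
    of two partial isometries supported on the piece [f]; for [f = 1] this
    bounds the norm without any order structure. *)
Lemma boolean_piece_midpoint (M : R) (w : A) : 0 < M ->
  (forall f c, boolean_piece f -> f != 0 -> f * w = c *: f ->
    complex.Re `|c| <= M) ->
  forall y, lspan range_projections y ->
  forall f c, boolean_piece f -> f * w = c *: f + f * y ->
  exists V V', [/\ star V * V = f, f * V = V, star V' * V' = f, f * V' = V' &
    f * w = (M / 2)%:C%C *: (V + V')].
Proof.
move=> M0 wM y; elim=> [|c' _ {}y [g [p ->]] _ IH] f c fP fw.
  rewrite mulr0 addr0 in fw; have [fs ff] := boolean_pieceP fP.
  have [f0|f0] := eqVneq f 0.
    by exists 0, 0; rewrite f0 star0 !mulr0 mul0r addr0 scaler0.
  have [z [z' [zz zz' cE]]] := unimodular_midpoint M0 (wM _ _ fP f0 fw).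
  have norm_z (t : R[i]) : t^* * t = 1 -> star (t *: f) * (t *: f) = f.
    by move=> tt; rewrite starZ fs -scalerAl -scalerAr ff scalerA tt scale1r.
  exists (z *: f), (z' *: f); split; try exact: norm_z.
  - by rewrite -scalerAr ff.
  - by rewrite -scalerAr ff.
  - by rewrite fw -scalerDl scalerA -cE.
have fe := boolean_piece_comm g p fP.
have ee := projection_id g p; have es := star_projection g p.
have f1P := boolean_pieceM g p fP; have f2P := boolean_pieceB g p fP.
move: (e g p) fe ee es f1P f2P fw => E fe ee es f1P f2P fw.
have fE' : f * (1 - E) = (1 - E) * f by rewrite mulrBr mulrBl mulr1 mul1r fe.
have E'E : (1 - E) * E = 0 by rewrite mulrBl mul1r ee subrr.
have EE' : E * (1 - E) = 0 by rewrite mulrBr mulr1 ee subrr.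
have [f1s f1id] := boolean_pieceP f1P; have [f2s f2id] := boolean_pieceP f2P.
have [_ ff] := boolean_pieceP fP.
have f12 : f * E * (f * (1 - E)) = 0.
  by rewrite fE' mulrA -(mulrA f) EE' mulr0 mul0r.
have f21 : f * (1 - E) * (f * E) = 0.
  by rewrite fe mulrA -(mulrA f) E'E mulr0 mul0r.
have f_sum : f * E + f * (1 - E) = f by rewrite -mulrDr addrC subrK mulr1.
have [|V1 [V1' [V1V1 fV1 V1V1' fV1' w1]]] := IH (f * E) (c + c') f1P.
  rewrite {1}fe -mulrA fw mulrDr -scalerAr mulrA -fe scalerDl -addrA.
  by rewrite mulrDr -scalerAr -(mulrA f E E) ee.
have [|V2 [V2' [V2V2 fV2 V2V2' fV2' w2]]] := IH (f * (1 - E)) c f2P.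
  rewrite {1}fE' -(mulrA _ f w) fw mulrDr -scalerAr (mulrA (1 - E) f) -fE'.
  congr (_ + _).
  by rewrite mulrDr -scalerAr -(mulrA f _ E) E'E mulr0 scaler0 add0r.
have combine (X1 X2 : A) : star X1 * X1 = f * E -> f * E * X1 = X1 ->
    star X2 * X2 = f * (1 - E) -> f * (1 - E) * X2 = X2 ->
    star (X1 + X2) * (X1 + X2) = f /\ f * (X1 + X2) = X1 + X2.
  move=> X11 fX1 X22 fX2; split; last first.
    by rewrite mulrDr -{1}fX1 -{1}fX2 !(mulrA f) ff fX1 fX2.
  have X12 : star X1 * X2 = 0.
    rewrite -fX1 -fX2 starM f1s -(mulrA (star X1)) (mulrA (f * E)).
    by rewrite f12 mul0r mulr0.
  have X21 : star X2 * X1 = 0.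
    rewrite -fX1 -fX2 starM f2s -(mulrA (star X2)) (mulrA (f * (1 - E))).
    by rewrite f21 mul0r mulr0.
  by rewrite starD mulrDl !mulrDr X11 X22 X12 X21 addr0 add0r.
have [VV fV] := combine _ _ V1V1 fV1 V2V2 fV2.
have [VV' fV'] := combine _ _ V1V1' fV1' V2V2' fV2'.
exists (V1 + V2), (V1' + V2'); split=> //.
by rewrite -{1}f_sum mulrDl w1 w2 -scalerDr addrACA.
Qed.

(** A nonzero element of the diagonal is close to a combination of pieces with
    a large scalar on some nonzero piece.  That piece lies above a range
    projection, which in turn lies above one that kills the element. *)
Lemma diagonal_eq0 T : D T ->
  (forall g p, exists k r, e g p * e k r = e k r /\ e k r * T = 0) -> T = 0.
Proof.
move=> DT dense; apply: cnorm_small_eq0 => d d0; have d2 : 0 < d / 2 by lra.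
have [w wE Tw] := diagonal_closed_span DT d2.
have small f c : boolean_piece f -> f != 0 -> f * w = c *: f ->
    complex.Re `|c| <= d / 2.
  move=> fP f0 fw; have [g [p gf]] := boolean_piece_above fP f0.
  have [k [r [gk kT]]] := dense g p.
  have kg : e k r * e g p = e k r by rewrite projection_comm.
  have kf : e k r * f = e k r by rewrite -kg -mulrA gf.
  have kw : e k r * (w - T) = c *: e k r.
    by rewrite mulrBr kT subr0 -kf -mulrA fw -scalerAr.
  have k1 : cnorm (e k r) = 1.
    by apply: cnorm_projection; rewrite ?star_projection ?projection_id
      ?projection_neq0.
  rewrite -[complex.Re _]mulr1 -k1 -cnormZ -kw.
  apply: le_trans (cnormM_le _ _) _.
  by rewrite k1 mul1r -cnormN opprB ltW.
have [|V [V' [VV _ VV' _ wE']]] :=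
  @boolean_piece_midpoint _ w d2 small _ wE 1 0 boolean_piece1.
  by rewrite scale0r add0r.
have w_le : cnorm w <= d / 2.
  rewrite -[w]mul1r wE' cnormZ.
  have -> : complex.Re `|(d / 2 / 2)%:C%C : R[i]| = d / 2 / 2.
    by rewrite normc_def /= expr0n addr0 sqrtr_sqr ger0_norm//; lra.
  have := cnormD_le V V'; rewrite (cnorm_isometry VV) (cnorm_isometry VV').
  by move=> VV2; have := ler_wpM2l (ltW (divr_gt0 d2 (ltr0Sn R 1))) VV2; lra.
rewrite -(subrK w T); apply: le_trans (cnormD_le _ _) _.
by move: Tw; lra.
Qed.

Lemma closed_span_monomials :
  cstar_generated (range u `|` range s) = setT ->
  forall x, norm_closure
    (lspan [set t | exists a p b q, t = v a p * star (v b q)]) x.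
Proof.
move=> gen x; have : [set: A] x by [].
rewrite -gen; move: x; apply: cstar_generated_min.
  apply: closed_lspan_cstar.
    move=> _ _ [a [p [b [q ->]]]] [a' [p' [b' [q' ->]]]].
    have [[c [r [d [w ->]]]]|->] := monomialM a p b q a' p' b' q'.
      by apply: sub_lspan; exists c, r, d, w.
    by left.
  move=> _ [a [p [b [q ->]]]]; apply: sub_lspan; exists b, q, a, p.
  by rewrite starM starK.
have v1 : v 1%g 1%g = 1 by rewrite -u_isometryE u1.
move=> _ [[g _ <-]|[p _ <-]]; apply: sub_closure; apply: sub_lspan.
  by exists g, 1%g, 1%g, 1%g; rewrite v1 star1 mulr1 u_isometryE.
by exists 1%g, p, 1%g, 1%g; rewrite v1 star1 mulr1 s_isometryE.
Qed.

(** * Off-diagonal monomials move small range projections off themselves *)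

Hypothesis Hminimal : minimal_action theta.
Hypothesis Hnondegenerate : nondegenerate_pair G P.
Hypothesis Hfinite : forall p q : P, p != q -> forall g : G,
  finite_set [set h : G | (theta p h * (theta q h)^-1)%g = g].

(** Injective endomorphisms of a finite group are bijective, so that minimality
    leaves only the trivial group. *)
Lemma minimal_finite_trivial : finite_set [set: G] -> forall g : G, g = 1%g.
Proof.
move=> /finite_seqP[l lE] g.
have inl x : x \in undup l.
  by rewrite mem_undup; have : [set: G] x by []; rewrite lE.
suff : (\bigcap_(p in [set: P]) range (theta p)) g by rewrite Hminimal.
move=> p _.
have [|||_ lp] := @uniq_min_size _ (map (theta p) (undup l)) (undup l).
- by rewrite map_inj_uniq ?undup_uniq//; exact: ads_theta_inj Hads p.
- by move=> x _; exact: inl.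
- by rewrite size_map.
have : g \in map (theta p) (undup l) by rewrite lp inl.
by move=> /mapP[x _ ->]; exists x.
Qed.

(** The monomial of [(a, p)] and [(b, q)] sends the point [b * theta q h] of
    [G] to [a * theta p h].  It has finitely many fixed points if [p] and [q]
    differ, and none if only [a] and [b] do; a whole coset of fixed points would
    therefore make [G] finite. *)
Lemma exists_moved_point a p b q k0 r0 : (a, p) <> (b, q) ->
  exists2 k, range (theta r0) (k0^-1 * k)%g &
    forall h, k = (b * theta q h)%g -> k <> (a * theta p h)%g.
Proof.
move=> apbq; apply: contrapT => fixed.
have fix_all x : exists h, (k0 * theta r0 x = b * theta q h)%g /\
    (k0 * theta r0 x = a * theta p h)%g.
  apply: contrapT => nfix; apply: fixed; exists (k0 * theta r0 x)%g.
    by exists x; rewrite // mulKg.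
  by move=> h kb ka; apply: nfix; exists h.
have [pq|pq] := eqVneq p q.
  have [h [kb ka]] := fix_all 1%g; apply: apbq; rewrite pq; congr (_, _).
  by apply: (mulIg (theta q h)); rewrite -kb ka pq.
have fin := Hfinite pq (a^-1 * b)%g.
pose back h := xget 1%g [set x | (k0 * theta r0 x = a * theta p h)%g].
have G_fin : finite_set [set: G].
  apply: sub_finite_set (finite_image back fin) => x _.
  have [h [kb ka]] := fix_all x; exists h.
    apply: (mulgI a); rewrite mulVKg; apply: (mulIg (theta q h)).
    by rewrite mulgA mulgVK -ka -kb.
  have bx : (k0 * theta r0 (back h) = a * theta p h)%g.
    by apply: (@xgetPex _ 1%g [set x | (k0 * theta r0 x = a * theta p h)%g]);
      exists x.
  by apply: (ads_theta_inj Hads (p := r0)); apply: (mulgI k0); rewrite bx.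
have G1 := minimal_finite_trivial G_fin.
have [[g]|P1] := Hnondegenerate; first by rewrite (G1 g) eqxx.
by move: pq; rewrite (P1 p) (P1 q) eqxx.
Qed.

(** Around a moved point, minimality provides cosets small enough to be disjoint
    from their images. *)
Lemma monomial_compression_eq0 a p b q k0 r0 : (a, p) <> (b, q) ->
  exists k r, e k0 r0 * e k r = e k r /\
    e k r * (v a p * star (v b q)) * e k r = 0.
Proof.
move=> apbq; have [k k0k moved] := exists_moved_point k0 r0 apbq.
have below r z : r = (r0 * z)%g -> e k0 r0 * e k r = e k r.
  by move=> rz; rewrite projection_comm; exact: projection_below rz k0k.
have [[h kb]|nkb] := pselect (exists h, k = (b * theta q h)%g); last first.
  have [x [y [xy _]]] := least_common_multiple q r0.
  exists k, (q * x)%g; split; first exact: (below _ y).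
  have off : e b q * e k (q * x)%g = 0.
    rewrite projection_comm; apply: (projection_off (erefl _)) => -[h _ hE].
    by apply: nkb; exists h; rewrite hE mulVKg.
  have -> : star (v b q) = star (v b q) * e b q.
    by rewrite range_projectionE mulrA semidirect_isometryV mul1r.
  move: (e b q) (e k _) off => E F off.
  by rewrite -!mulrA off !mulr0.
have [m mP] : exists m, ~ range (theta m) (k^-1 * (a * theta p h))%g.
  apply: contrapT => all_m; apply: (moved h kb).
  suff : (\bigcap_(m in [set: P]) range (theta m)) (k^-1 * (a * theta p h))%g.
    rewrite Hminimal => /= k1; apply: (mulgI k^-1%g).
    by rewrite k1 mulVg.
  by move=> m _; apply: contrapT => nm; apply: all_m; exists m.
have [x1 [y1 [xy1 _]]] := least_common_multiple q m.
have [x2 [y2 [xy2 _]]] := least_common_multiple p m.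
have [x3 [y3 [xy3 _]]] := least_common_multiple q r0.
have [n nP] := common_multiple [:: x1; x2; x3].
have [z1 nz1] : exists z, n = (x1 * z)%g by apply: nP; rewrite !inE eqxx.
have [z2 nz2] : exists z, n = (x2 * z)%g by apply: nP; rewrite !inE eqxx !orbT.
have [z3 nz3] : exists z, n = (x3 * z)%g by apply: nP; rewrite !inE eqxx !orbT.
exists k, (q * n)%g; split.
  by apply: (below _ (y3 * z3)%g); rewrite nz3 !mulgA xy3.
have kE : v k (q * n)%g = v b q * v h n by rewrite semidirect_isometryM kb.
have off : e k (q * n)%g * e (a * theta p h)%g (p * n)%g = 0.
  apply: projection_disjoint => g1 g2 kg; apply: mP.
  have -> : (k^-1 * (a * theta p h) =
      theta (q * n) g1 * (theta (p * n) g2)^-1)%g.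
    by apply: (mulgI k); rewrite mulVKg mulgA kg mulgK.
  have gm := range_theta_subgroup m; apply: (subgroupM gm).
    exists (theta (y1 * z1)%g g1) => //.
    by rewrite -(ads_thetaM Hads) mulgA -xy1 -mulgA -nz1.
  apply: (subgroupV gm); exists (theta (y2 * z2)%g g2) => //.
  by rewrite -(ads_thetaM Hads) mulgA -xy2 -mulgA -nz2.
rewrite -(mulrA (e k _) (v a p * _)).
have -> : v a p * star (v b q) * e k (q * n)%g =
    e (a * theta p h)%g (p * n)%g * (v (a * theta p h)%g (p * n)%g *
      star (v k (q * n)%g)); last by rewrite mulrA off mul0r.
rewrite !range_projectionE -(semidirect_isometryM a) kE.
set w := star (v b q * v h n).
have -> : v a p * star (v b q) * (v b q * v h n * w) = v a p * v h n * w.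
  by rewrite !mulrA -(mulrA (v a p)) semidirect_isometryV mulr1.
rewrite mulrA -(mulrA (v a p * v h n)) semidirect_isometryM.
by rewrite semidirect_isometryV mulr1.
Qed.

(** * Maximality of the diagonal *)

Lemma diagonal_maximal_abelian (Theta : A -> A) :
  cstar_generated (range u `|` range s) = setT ->
  conditional_expectation D Theta -> faithful_map Theta -> maximal_abelian D.
Proof.
move=> gen ThetaE faithful.
split; [exact: diagonal_cstar|exact: diagonal_abelian|].
move=> B Balg Bab DB; apply/seteqP; split=> // x Bx.
have ThetaB a b : Theta (a - b) = Theta a - Theta b.
  by have := condexp_linear ThetaE (-1) b a; rewrite !scaleN1r !(addrC (- _)).
have Theta0 : Theta 0 = 0 by rewrite -(subrr 0) ThetaB !subrr.
pose y := x - Theta x.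
have DT z : D (Theta z) := condexp_range ThetaE z.
have y0 : Theta y = 0 by rewrite ThetaB (condexp_id ThetaE (DT x)) subrr.
have By : B y.
  rewrite /y -scaleN1r; apply: (cstar_subalgebraD Balg) => //.
  by apply: (cstar_subalgebraZ Balg); exact: DB.
suff yz0 z : Theta (y * z) = 0.
  have sy0 : star y = 0 by apply: faithful; rewrite starK yz0.
  have -> : x = Theta x by apply/eqP; rewrite -subr_eq0 -[_ - _]starK sy0 star0.
  exact: DT.
apply: (closure_bounded (C := [set 0]) (f := fun z => Theta (y * z))
  (K := cnorm y) _ _ _ _ (closed_span_monomials gen z)).
- by move=> a b; rewrite mulrBr ThetaB.
- move=> a; apply: le_trans (condexp_contractive ThetaE _) _.
  exact: cnormM_le.
- exact: set0_closed.
apply: (lspan_linear (B := [set 0]) (f := fun z => Theta (y * z))).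
- by [].
- by move=> a b -> ->; rewrite addr0.
- by move=> c a ->; rewrite scaler0.
- by rewrite mulr0.
- by move=> c a b; rewrite mulrDr -scalerAr (condexp_linear ThetaE).
move=> _ [a [p [b [q ->]]]].
have [[-> ->]|apbq] := pselect ((a, p) = (b, q)).
  rewrite -range_projectionE -[y]mul1r.
  rewrite (condexp_bimodule ThetaE _ diagonal1 (projection_diagonal b q)).
  by rewrite y0 mulr0 mul0r.
apply: diagonal_eq0; first exact: DT.
move=> k0 r0; have [k [r [k0k kt]]] := monomial_compression_eq0 k0 r0 apbq.
exists k, r; split=> //; move: (v a p * star (v b q)) kt => t kt.
have De := projection_diagonal k r.
(* Compressing by the projection amounts to multiplying by it, since both lie
   in the commutative diagonal, and the projection can be moved past [y]. *)
rewrite -projection_id -mulrA (diagonal_abelian De (DT _)) mulrA.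
rewrite -(condexp_bimodule ThetaE _ De De).
by rewrite mulrA (Bab _ _ (DB _ De) By) -!(mulrA y) kt mulr0 Theta0.
Qed.

End BoundaryRelations.

Theorem theorem3p10 (R : realType) (G : groupType) (P : monoidType)
  (theta : P -> {multiplicative G -> G})
  (Hads : algebraic_dynamical_system theta)
  (Hdirected : directed_monoid P)
  (Hminimal : minimal_action theta)
  (Hnondegenerate : nondegenerate_pair G P)
  (Q : cstarAlgType R) (u : G -> Q) (s : P -> Q)
  (HQ : is_boundary_quotient theta u s)
  (Theta : Q -> Q)
  (HTheta : conditional_expectation (diagonal_subalgebra u s) Theta)
  (HThetaE : forall (g h : G) (p q : P),
     Theta (u g * s p * star (s q) * star (u h)) =
     if (g == h) && (p == q) then range_projection u s g p else 0)
  (HThetafaithful : faithful_map Theta)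
  (Hfinite : forall p q : P, p != q -> forall g : G,
     finite_set [set h : G | (theta p h * (theta q h)^-1)%g = g]) :
  cartan_subalgebra (diagonal_subalgebra u s).
Proof.
have Hrel := bq_relations HQ; have gen := bq_generated HQ.
split.
- exact: (diagonal_maximal_abelian (theta := theta) _ _ _ _ _ _ gen HTheta).
- exact: (diagonal1 Hrel).
- by exists Theta.
apply/seteqP; split=> // x _; have : [set: Q] x by [].
rewrite -gen; move: x.
apply: cstar_generated_min; first exact: cstar_generated_cstar.
move=> _ [[g _ <-]|[p _ <-]]; apply: cstar_generated_sub.
  by rewrite (u_isometryE Hrel); exact: (isometry_normalizes Hads Hdirected Hrel).
by rewrite (s_isometryE Hrel); exact: (isometry_normalizes Hads Hdirected Hrel).
Qed.
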